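(* Let $m,\ell,i,q$ be non-negative integers satisfying $\ell=q-i\ge 2$ and $m\ge q+2i+1$, let $a,b$ be complex numbers, and let $F(x)$ be the formal power series determined by $$F(x)=\frac{x^m}{1-ax^q-bx^\ell F(x)}.$$ Then $H_{m+1}(F)=(-1)^{\binom{m+1}{2}}$, and for all integers $n\ge 0$, \begin{align*} H_{(n+1)(m+\ell)}(F)&=(-1)^{n\left[\binom{m-2i-1}{2}+(i-1)\right]+(n+1)\binom{\ell-1}{2}+\binom{m+1}{2}}\,b^{(n+1)^2(m+\ell)-(n+1)(m+1)},\\ H_{(n+1)(m+\ell)+i+1}(F)&=(-1)^{n\left[\binom{m-2i-1}{2}+(i-1)\right]+(n+1)\binom{\ell-1}{2}+\binom{i+1}{2}+\binom{m+1}{2}}\\ &\qquad\cdot b^{(n+1)^2(m+\ell)+n(2i-m+1)+i-m}\,[(n+1)a]^{i+1},\\ H_{(n+1)(m+\ell)+m-i}(F)&=(-1)^{(n+1)\left[\binom{m-2i-1}{2}+\binom{\ell-1}{2}\right]+n(i-1)+\binom{i+1}{2}+\binom{m+1}{2}}\\ &\qquad\cdot b^{(n+1)^2(\ell+m)+n(m-2i-1)+m-3i-2}\,[(n+1)a]^{i+1},\\ H_{(n+1)(m+\ell)+m+1}(F)&=(-1)^{(n+1)\left[\binom{m-2i-1}{2}+\binom{\ell-1}{2}+i+1\right]+\binom{m+1}{2}}\,b^{(n+1)^2(m+\ell)+(n+1)(m+1)}, \end{align*} and $H_N(F)=0$ for every positive integer $N$ different from $m+1$ and not of one of the forms $(n+1)(m+\ell)$,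 $(n+1)(m+\ell)+i+1$, $(n+1)(m+\ell)+m-i$, $(n+1)(m+\ell)+m+1$ with $n\ge 0$.
   Context: For a formal power series $A(x)=\sum_{n\ge 0}a_nx^n$, the Hankel determinant is $H_N(A)=\det(a_{i+j})_{0\le i,j\le N-1}$ for $N\ge 1$, and $H_0(A)=1$ by convention. Powers use the convention $0^0=1$. *)

(* Defs.v *)
From mathcomp Require Import all_boot all_order all_algebra.
From mathcomp Require Import reals.
From mathcomp Require Export complex.

Set Implicit Arguments.
Unset Strict Implicit.
Unset Printing Implicit Defensive.

Import GRing.Theory.
Local Open Scope ring_scope.

(* A formal power series is its coefficient sequence.  The multiplication is
   the Cauchy product, not the pointwise product of functions. *)
Definition fps (K : Type) : Type := nat -> K.

Section FormalPowerSeries.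
Variable K : comUnitRingType.
Implicit Types A B D : fps K.

Definition fps_Xn (d : nat) : fps K := fun n => (n == d)%:R.

Definition fps_sub A B : fps K := fun n => A n - B n.

Definition fps_scale (c : K) A : fps K := fun n => c * A n.

Definition fps_mul A B : fps K := fun n => \sum_(k < n.+1) A k * B (n - k)%N.

(* A = B / D in K[[x]]: the series invertible in K[[x]] are exactly those whose
   constant term is a unit, and for such a D the quotient B / D is the unique A
   with A * D = B. *)
Definition fps_is_quotient A B D : Prop :=
  D 0%N \is a GRing.unit /\ fps_mul A D =1 B.

(* The determinant of the empty matrix is 1, so hankel A 0 = 1. *)
Definition hankel A (N : nat) : K :=
  \det (\matrix_(i < N, j < N) A (i + j)%N).

End FormalPowerSeries.

Arguments fps_Xn {K} d.

(* Main.v *)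
From HB Require Import structures.
Require Import Defs.
From mathcomp Require Import all_boot all_order all_algebra.
From mathcomp Require Import reals.
From mathcomp Require Import complex.
From mathcomp Require Import boolp.
From mathcomp Require Import ring zify.

(** The proof is a continued fraction expansion of [F] that turns out to be
    periodic up to a change of one parameter.

    The engine is the Gessel-Xin reduction.  If [F = x^d / E] with [E 0 = 1], the
    infinite Hankel matrix of [F] has generating function
    [(x F(x) - y F(y)) / (x - y)].  Multiplying it by [E(x) E(y)] is a congruence
    by a unitriangular Toeplitz matrix, so no leading principal minor changes,
    and it gives [(x^(d+1) E(y) - y^(d+1) E(x)) / (x - y)].  That matrix is block
    diagonal: a (d+1)-block with ones on its antidiagonal and zeros above it,
    followed by minus the Hankel matrix of [G], where [G] is what remains of [E]
    after its first [d+2] coefficients are dropped.  Hence the determinants of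
    [F] of size [1..d] vanish and those of size [d+1+N] are, up to sign, those of
    [G] of size [N] ([hankel_reciprocal0], [hankel_reciprocal]).

    Write [F = x^m f], so that [f = 1 / E] with [E = 1 - a x^q - b x^(l+m) f], and
    put [R_c = c x^i + b F].  For [c != 0] four reductions lead
    from [R_c] to [R_(a+c)], up to constant factors:
      [R_c = c x^i (1 + (b/c) x^(m-i) f)],
      [x^(m-2i-2) / (E + (b/c) x^(m-i))],
      [x^i (1 - c x^q f)],
      [x^(l-2) / (E - c x^q)].
    The first and the third rest on the identity [(1 + P f) (1 - P w) = 1] for
    [f = 1 / E] and [w = 1 / (E + P)] ([shift_inv]), which turns a numerator
    [1 + P f] into a denominator.  The four
    block sizes [i+1], [m-2i-1], [i+1], [l-1] add up to [m+l], which is the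
    period, and their partial sums are the only sizes at which a determinant can
    be nonzero.  For [c = 0] the first three reductions collapse into a single one
    of size [m+1], because [R_0 = b F]; the resulting formulas agree with the case
    [c != 0], so the statements about one period hold for every [c]
    ([hankel_remainder_left], [hankel_remainder_right], [hankel_remainder_tail],
    [hankel_remainder_off]).

    Starting from [F] itself, a reduction of size [m+1] and one of size [l-1] reach
    [R_a]; each period then adds [a] to the parameter, so after [n] further
    periods the remainder is [R_((n+1) a)] ([hankel_start_period]).  This is where
    the factor [(n+1) a] comes from. *)

Set Implicit Arguments.
Unset Strict Implicit.
Unset Printing Implicit Defensive.

Import GRing.Theory.
Local Open Scope ring_scope.
Local Open Scope complex_scope.

(** * The ring of formal power series *)

Section Ring.
Variable K : comUnitRingType.
Implicit Types A B D : fps K.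

HB.instance Definition _ := gen_eqMixin (fps K).
HB.instance Definition _ := gen_choiceMixin (fps K).

Definition fps_add A B : fps K := fun n => A n + B n.
Definition fps_opp A : fps K := fun n => - A n.

Fact fps_addA : associative fps_add.
Proof. by move=> A B D; apply/funext => n; apply: addrA. Qed.
Fact fps_addC : commutative fps_add.
Proof. by move=> A B; apply/funext => n; apply: addrC. Qed.
Fact fps_add0 : left_id (fun=> 0) fps_add.
Proof. by move=> A; apply/funext => n; apply: add0r. Qed.
Fact fps_addN : left_inverse (fun=> 0) fps_opp fps_add.
Proof. by move=> A; apply/funext => n; apply: addNr. Qed.

HB.instance Definition _ :=
  GRing.isZmodule.Build (fps K) fps_addA fps_addC fps_add0 fps_addN.

(** Cutting series down to polynomials carries the ring laws of [{poly K}] over to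
    the Cauchy product. *)
Definition fps_trunc (L : nat) A : {poly K} := \poly_(k < L) A k.

Lemma fps_mul_trunc L A B n : (n < L)%N ->
  fps_mul A B n = (fps_trunc L A * fps_trunc L B)`_n.
Proof.
move=> ltnL; rewrite coefM; apply: eq_bigr => k _.
have lekn : (k <= n)%N by rewrite -ltnS.
rewrite !coef_poly (leq_ltn_trans lekn ltnL).
by rewrite (leq_ltn_trans (leq_subr k n) ltnL).
Qed.

Fact fps_mulC : commutative (@fps_mul K).
Proof.
by move=> A B; apply/funext => n; rewrite !(fps_mul_trunc _ _ (ltnSn n)) mulrC.
Qed.

Fact fps_mulA : associative (@fps_mul K).
Proof.
have assoc3 L (A B D : fps K) n : (n < L)%N -> fps_mul (fps_mul A B) D n =
    (fps_trunc L A * fps_trunc L B * fps_trunc L D)`_n.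
  move=> ltnL; rewrite coefM; apply: eq_bigr => k _.
  have lekn : (k <= n)%N by rewrite -ltnS.
  rewrite -(fps_mul_trunc _ _ (leq_ltn_trans lekn ltnL)) coef_poly.
  by rewrite (leq_ltn_trans (leq_subr k n) ltnL).
move=> A B D; apply/funext => n.
by rewrite fps_mulC !(assoc3 n.+1) // [_ * fps_trunc _ A]mulrC mulrA.
Qed.

Fact fps_mul1 : left_id (fps_Xn 0) (@fps_mul K).
Proof.
move=> A; apply/funext => n; rewrite /fps_mul big_ord_recl /= subn0 mul1r.
by rewrite big1 ?addr0 // => k _; rewrite mul0r.
Qed.

Fact fps_mulDl : left_distributive (@fps_mul K) fps_add.
Proof.
move=> A B D; apply/funext => n; rewrite /fps_add -big_split /=.
by apply: eq_bigr => k _; rewrite mulrDl.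
Qed.

Fact fps_1neq0 : (fps_Xn 0 : fps K) != 0.
Proof. by apply/eqP => /(congr1 (@^~ 0%N))/eqP; apply/negP/oner_neq0. Qed.

HB.instance Definition _ := GRing.Zmodule_isComNzRing.Build (fps K)
  fps_mulA fps_mulC fps_mul1 fps_mulDl fps_1neq0.

Lemma fps_Xn0 : fps_Xn 0 = 1 :> fps K. Proof. by []. Qed.
Lemma fps_coefD A B n : (A + B) n = A n + B n. Proof. by []. Qed.
Lemma fps_coefN A n : (- A) n = - A n. Proof. by []. Qed.
Lemma fps_coefM A B n : (A * B) n = \sum_(k < n.+1) A k * B (n - k)%N.
Proof. by []. Qed.
Lemma fps_sumE (I : Type) (r : seq I) (G : I -> fps K) n :
  (\sum_(j <- r) G j) n = \sum_(j <- r) G j n.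
Proof. by elim/big_rec2: _ => // j x y _ <-. Qed.

Lemma fps_coefXnM d A n : (fps_Xn d * A) n = if (n < d)%N then 0 else A (n - d)%N.
Proof.
rewrite fps_coefM; case: ltnP => [ltnd|ledn].
  rewrite big1 // => k _; rewrite /fps_Xn ltn_eqF ?mul0r //.
  by apply: leq_ltn_trans ltnd; rewrite -ltnS.
rewrite (bigD1 (inord d)) //= /fps_Xn inordK // eqxx mul1r big1 ?addr0 //.
move=> k /negbTE nkd; case: eqP => [kd|]; last by rewrite mul0r.
by move: nkd; rewrite -val_eqE /= inordK // kd eqxx.
Qed.

Lemma fps_XnD d e : fps_Xn d * fps_Xn e = fps_Xn (d + e) :> fps K.
Proof.
apply/funext => n; rewrite fps_coefXnM /fps_Xn.
by case: ltnP => h; [case: eqP => //|congr (_%:R)]; lia.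
Qed.

Definition fps_const (c : K) : fps K := fps_scale c 1.

Lemma fps_coefCM c A n : (fps_const c * A) n = c * A n.
Proof.
rewrite fps_coefM big_ord_recl big1 => [|k _].
  by rewrite addr0 subn0 /fps_const /fps_scale mulr1.
by rewrite /fps_const /fps_scale !(mulr0, mul0r).
Qed.

Lemma fps_constM c d : fps_const c * fps_const d = fps_const (c * d).
Proof. by apply/funext => n; rewrite fps_coefCM /fps_const /fps_scale mulrA. Qed.
Lemma fps_constN c : fps_const (- c) = - fps_const c.
Proof. by apply/funext => n; rewrite /fps_const /fps_scale mulNr. Qed.
Lemma fps_constD c d : fps_const (c + d) = fps_const c + fps_const d.
Proof. by apply/funext => n; rewrite /fps_const /fps_scale mulrDl. Qed.
Lemma fps_const0 : fps_const 0 = 0.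
Proof. by apply/funext => n; rewrite /fps_const /fps_scale mul0r. Qed.
Lemma fps_const1 : fps_const 1 = 1.
Proof. by apply/funext => n; rewrite /fps_const /fps_scale mul1r. Qed.

Lemma fps_exp_coef0 A k n : A 0%N = 0 -> (n < k)%N -> (A ^+ k) n = 0.
Proof.
move=> A0; elim: k n => // k IH n ltnk; rewrite exprS fps_coefM big1 // => j _.
case: (posnP j) => [-> | j0]; first by rewrite A0 mul0r.
by rewrite IH ?mulr0 //; have := ltn_ord j; lia.
Qed.

(** The geometric series in [g = 1 - A]: as [g] has no constant term, [g ^+ k] does
    not reach the coefficients below [k], so coefficient [n] of the inverse can be
    read off the partial sum [S n.+1]. *)
Lemma fps_inv_ex A : A 0%N = 1 -> exists B, B * A = 1.
Proof.
move=> A0; pose g := 1 - A.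
have g0 : g 0%N = 0 by rewrite /g fps_coefD fps_coefN A0 subrr.
pose S L := \sum_(k < L) g ^+ k.
have SE n L : (n < L)%N -> S L n = S n.+1 n.
  move=> ltnL; rewrite /S -!(big_mkord xpredT (fun k => g ^+ k)) !fps_sumE.
  rewrite (big_cat_nat _ (n := n.+1)) //= [X in _ + X]big1_seq ?addr0 // => k.
  rewrite mem_index_iota => /andP[_ /andP[ltnk _]]; exact: fps_exp_coef0.
exists (fun n => S n.+1 n); apply/funext => n.
transitivity ((S n.+1 * A) n).
  rewrite !fps_coefM; apply: eq_bigr => k _; congr (_ * _).
  by rewrite (SE k n.+1).
have -> : A = - (g - 1) by rewrite /g; ring.
rewrite mulrN mulrC -subrX1 fps_coefN fps_coefD fps_coefN.
by rewrite fps_exp_coef0 // sub0r opprK.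
Qed.

Lemma fps_order A D d : A * D = fps_Xn d -> D 0%N = 1 ->
  forall j, (j < d)%N -> A j = 0.
Proof.
move=> AD D0; elim/ltn_ind => j IHj ltjd.
have := congr1 (@^~ j) AD; rewrite /= fps_coefM big_ord_recr /= subnn D0 mulr1.
rewrite big1 ?add0r => [->|k _]; last by rewrite IHj ?mul0r // (ltn_trans _ ltjd).
by rewrite /fps_Xn ltn_eqF.
Qed.

Lemma fps_mulXnI d : injective (fun A : fps K => fps_Xn d * A).
Proof.
move=> A B AB; apply/funext => n; have := congr1 (@^~ (n + d)%N) AB.
by rewrite /= !fps_coefXnM ltnNge leq_addl /= addnK.
Qed.

Lemma fps_factor A D d : A * D = fps_Xn d -> D 0%N = 1 ->
  exists2 f, A = fps_Xn d * f & f * D = 1.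
Proof.
move=> AD D0; have Af : A = fps_Xn d * (fun n => A (n + d)%N).
  apply/funext => n; rewrite fps_coefXnM; case: ltnP => [ltnd|led].
    exact: fps_order AD D0 _ ltnd.
  by rewrite subnK.
exists (fun n => A (n + d)%N) => //; apply: (@fps_mulXnI d).
by rewrite /= mulr1 mulrA -Af.
Qed.

End Ring.

(** * Reduction of Hankel determinants *)

Section GesselXin.
Variable K : comUnitRingType.
Implicit Types E F G u : fps K.

Lemma hankelZ c F N : hankel (fps_const c * F) N = c ^+ N * hankel F N.
Proof.
rewrite /hankel -detZ; congr (\det _).
by apply/matrixP => i j; rewrite !mxE fps_coefCM.
Qed.

Lemma hankel_head0 F N : (0 < N)%N -> (forall j, (j < N)%N -> F j = 0) ->
  hankel F N = 0.
Proof.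
case: N => // N _ F0; rewrite /hankel (expand_det_row _ ord0) big1 // => j _.
by rewrite !mxE add0n F0 ?mul0r.
Qed.

(** Expansion along the first row, whose only nonzero entry is the last one,
    leaves the matrix of the same shape one size down. *)
Lemma det_antitriangular E d :
  \det (\matrix_(i < d.+1, j < d.+1) if (d <= i + j)%N then E (i + j - d)%N else 0)
  = (-1) ^+ 'C(d.+1, 2) * E 0%N ^+ d.+1.
Proof.
elim: d => [|d IHd]; first by rewrite det_mx11 mxE /= mul1r expr1.
rewrite (expand_det_row _ ord0) (bigD1 ord_max) //= big1 ?addr0 => [|j jmax].
  rewrite mxE add0n leqnn subnn /cofactor [X in \det X](_ : _ = \matrix_(i < d.+1,
      j < d.+1) if (d <= i + j)%N then E (i + j - d)%N else 0).
    by rewrite IHd add0n [in RHS]binS bin1 exprD (exprS (E 0%N) d.+1) /=; ring.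
  apply/matrixP => i j; rewrite !mxE lift_max lift0.
  by rewrite addSn ltnS subSS.
rewrite mxE add0n ifN ?mul0r // -ltnNge ltn_neqAle -ltnS ltn_ord andbT.
by apply: contra jmax => /eqP h; apply/eqP/val_inj.
Qed.

(** The left-hand side is the coefficient of [x^i y^j] in
    [E(x) E(y) (x F(x) - y F(y)) / (x - y)], and the right-hand side that of
    [(x^(d+1) E(y) - y^(d+1) E(x)) / (x - y)].  The division by [x - y] is avoided
    by comparing the entries on an antidiagonal: multiplying by [x - y] becomes
    the recurrence [MS], which determines everything from the row [i = 0]. *)
Lemma congruent_hankel_entry E F d : F * E = fps_Xn d -> E 0%N = 1 ->
  forall i j : nat,
  \sum_(k < i.+1) \sum_(l < j.+1) E (i - k)%N * E (j - l)%N * F (k + l)%N =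
  if (i <= d)%N && (j <= d)%N then if (d <= i + j)%N then E (i + j - d)%N else 0
  else if (d < i)%N && (d < j)%N then - E (i + j - d)%N else 0.
Proof.
move=> FE E0; pose M i j := \sum_(k < i.+1) \sum_(l < j.+1)
  E (i - k)%N * E (j - l)%N * F (k + l)%N.
have EF j : \sum_(l < j.+1) E (j - l)%N * F l = (j == d)%:R.
  rewrite -[RHS]/(fps_Xn d j) -FE; apply: eq_bigr => l _; exact: mulrC.
have M0 j : M 0%N j = (j == d)%:R.
  rewrite /M big_ord1 -EF; apply: eq_bigr => l _.
  by rewrite subn0 E0 mul1r add0n.
have MS i j : M i.+1 j =
    M i j.+1 + E i.+1 * (j == d)%:R - E j.+1 * (i == d)%:R.
  rewrite /M big_ord_recl.
  under [X in _ + X = _]eq_bigr => k _ do rewrite lift0 subSS.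
  (* The terms [k = 0] on the left and [l = 0] on the right are coefficients of
     [F * E]; the other terms of the two sums coincide. *)
  have -> : \sum_(k < i.+1) \sum_(l < j.+2)
        E (i - k)%N * E (j.+1 - l)%N * F (k + l)%N = E j.+1 * (i == d)%:R +
        \sum_(k < i.+1) \sum_(l < j.+1)
          E (i - k)%N * E (j - l)%N * F (k.+1 + l)%N.
    rewrite -EF big_distrr /= -big_split /=; apply: eq_bigr => k _.
    rewrite big_ord_recl subn0 addn0 mulrCA mulrA; congr (_ + _).
    by apply: eq_bigr => l _; rewrite lift0 subSS addnS addSn.
  rewrite [X in X + _ = _](_ : _ = E i.+1 * (j == d)%:R); first by ring.
  by rewrite -EF big_distrr; apply: eq_bigr => l _; rewrite /= subn0 mulrA.
move=> i j; rewrite -/(M i j); elim: i j => [|i IHi] j.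
  rewrite M0 add0n leq0n ltn0 /=; case: ltngtP => //= ->.
  by rewrite subnn E0.
rewrite MS IHi addnS addSn.
have subr x : ((x + d).+1 - d = x.+1)%N by rewrite -addSn addnK.
have subl x : ((d + x).+1 - d = x.+1)%N by rewrite addnC subr.
have ler x : (d <= (x + d).+1)%N by rewrite -addSn leq_addl.
have lel x : (d <= (d + x).+1)%N by rewrite -addnS leq_addr.
case: (ltngtP i d) => [id|id|->]; case: (ltngtP j d) => [jd|jd|->] /=;
  rewrite ?(mulr1, mulr0, addr0, subr0, add0r, sub0r, subr, subl, ler, lel) ?ltnSn
    ?andbF ?andbT ?oppr0 ?addNr ?subrr //.
- by rewrite ltnS leqNgt id.
- by rewrite ltnS leqNgt jd.
- by rewrite !ltnS (ltnW id) (ltnW jd).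
Qed.

(** A unitriangular congruence [T *m H *m T^T] makes the Hankel matrix of
    [F = x^d / E] block diagonal, with an antitriangular first block. *)
Lemma hankel_reciprocal E F d N : F * E = fps_Xn d -> E 0%N = 1 ->
  hankel F (d.+1 + N) =
  (-1) ^+ ('C(d.+1, 2) + N) * hankel (fun n => E (n + d + 2)%N) N.
Proof.
move=> FE E0.
pose T : 'M[K]_(d.+1 + N) :=
  \matrix_(i, j) if (j <= i)%N then E (i - j)%N else 0.
have detT : \det T = 1.
  rewrite det_trig => [|]; last first.
    by apply/is_trig_mxP => i j ij; rewrite mxE leqNgt ij.
  by rewrite big1 // => i _; rewrite mxE leqnn subnn.
pose H : 'M[K]_(d.+1 + N) := \matrix_(i, j) F (i + j)%N.
have -> : hankel F (d.+1 + N) = \det (T *m H *m T^T).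
  by rewrite !det_mulmx det_tr detT mul1r mulr1.
have sum_head (G : nat -> K) (n : nat) (i : 'I_n) :
    \sum_(k < n) (if (k <= i)%N then G k else 0) = \sum_(k < i.+1) G k.
  by rewrite -big_mkcond (big_ord_widen_cond n xpredT).
have entry i j : (T *m H *m T^T) i j =
    \sum_(k < i.+1) \sum_(l < j.+1) E (i - k)%N * E (j - l)%N * F (k + l)%N.
  rewrite mxE -[RHS](sum_head (fun k => \sum_(l < j.+1)
    E (i - k)%N * E (j - l)%N * F (k + l)%N)).
  under eq_bigr => l _ do rewrite mxE big_distrl /=.
  rewrite exchange_big /=; apply: eq_bigr => k _.
  under eq_bigr => l _ do rewrite !mxE.
  case: leqP => _; last by rewrite big1 // => l _; rewrite !mul0r.
  rewrite -[RHS](sum_head (fun l => E (i - k)%N * E (j - l)%N * F (k + l)%N)).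
  by apply: eq_bigr => l _; case: leqP => _; rewrite ?mulr0 // mulrAC.
have -> : T *m H *m T^T = block_mx
    (\matrix_(i < d.+1, j < d.+1) if (d <= i + j)%N then E (i + j - d)%N else 0)
    0 0 (- 1 *: \matrix_(i < N, j < N) E (i + j + d + 2)%N).
  apply/matrixP => i j; rewrite entry (congruent_hankel_entry FE E0).
  have lei (k : 'I_d.+1) : (k <= d)%N by rewrite -ltnS.
  have gtd k : (d.+1 + k <= d)%N = false by rewrite addSn ltnNge leq_addr.
  case: (split_ordP i) => i' ->; case: (split_ordP j) => j' ->;
    rewrite ?(block_mxEul, block_mxEur, block_mxEdl, block_mxEdr) !mxE /=.
  - by rewrite !lei.
  - by rewrite (gtd j') lei andbF ltnNge lei.
  - by rewrite (gtd i') [(d < j')%N]ltnNge lei andbF.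
  - rewrite !gtd /= !addSn !ltnS !leq_addr /= mulN1r; congr (- E _); lia.
by rewrite det_ublock det_antitriangular E0 expr1n mulr1 detZ mulrA -exprD.
Qed.

Lemma hankel_reciprocal0 E F d N : F * E = fps_Xn d -> E 0%N = 1 ->
  (0 < N <= d)%N -> hankel F N = 0.
Proof.
move=> FE E0 /andP[N0 leNd]; apply: hankel_head0 => // j ltjN.
by apply: fps_order FE E0 _ _; apply: leq_trans leNd.
Qed.

Lemma coef0_addXn u G d : u 0%N = 1 -> (u + fps_Xn d.+2 * G) 0%N = 1.
Proof. by move=> u0; rewrite fps_coefD fps_coefXnM /= addr0. Qed.

(** The form in which the reduction is iterated: the polynomial part [u] of the
    denominator disappears, and [G] is the next series to expand. *)
Lemma hankel_frac F u G d N :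
    F * (u + fps_Xn d.+2 * G) = fps_Xn d -> u 0%N = 1 ->
    (forall n, (d.+1 < n)%N -> u n = 0) ->
  hankel F (d.+1 + N) = (-1) ^+ ('C(d.+1, 2) + N) * hankel G N.
Proof.
move=> FE u0 u_small; rewrite (hankel_reciprocal _ FE) ?coef0_addXn //.
congr (_ * hankel _ _); apply/funext => n.
rewrite fps_coefD fps_coefXnM u_small ?add0r; last by lia.
by rewrite ifN; [congr G; lia | lia].
Qed.

Lemma hankel_frac0 F u G d N :
    F * (u + fps_Xn d.+2 * G) = fps_Xn d -> u 0%N = 1 -> (0 < N <= d)%N ->
  hankel F N = 0.
Proof. by move=> FE u0; apply: (hankel_reciprocal0 FE); apply: coef0_addXn. Qed.

(** The two factors are [f (E + P)] and [w E]. *)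
Lemma shift_inv f w E P : f * E = 1 -> w * (E + P) = 1 ->
  (1 + P * f) * (1 - P * w) = 1 :> fps K.
Proof.
move=> fE wEP.
have -> : 1 + P * f = f * (E + P) by rewrite mulrDr fE [f * P]mulrC.
have -> : 1 - P * w = w * E by rewrite -wEP; ring.
transitivity (f * E * (w * (E + P))); first by ring.
by rewrite fE wEP mulr1.
Qed.

End GesselXin.

(** * Signs *)

Lemma signrM2 (K : comPzRingType) (e n : nat) (c : K) :
  (-1) ^+ (e + n) * (- c) ^+ n = (-1) ^+ e * c ^+ n.
Proof. by rewrite exprD -mulrA -exprMn mulN1r opprK. Qed.

Lemma sign_bin2 (K : pzRingType) (n k : nat) :
  (-1) ^+ 'C(n + k.*2, 2) = (-1) ^+ ('C(n, 2) + k) :> K.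
Proof.
rewrite -signr_odd -[RHS]signr_odd; congr (_ ^+ nat_of_bool _).
elim: k => [|k IHk]; first by rewrite !addn0.
rewrite doubleS !addnS (binS _ 1) (binS _ 1) !bin1 addnS /= !oddD IHk /= oddD.
by rewrite -addbA addbb addbF.
Qed.

Lemma sign_exprz (K : fieldType) (z w : int) (n : nat) : z = n%:Z + 2 * w ->
  (-1) ^ z = (-1) ^+ n :> K.
Proof.
move=> ->; rewrite expfzDr ?oppr_eq0 ?oner_eq0 // -exprz_exp.
by rewrite -[(-1) ^ 2%:Z]/((-1) ^+ 2) sqrrN expr1n exp1rz mulr1.
Qed.

(** * The periodic expansion *)

(** With [l = p + 2] and [m = r + 2 + 2i], the numerators of the expansion are the
    powers [x^p], [x^r] and [x^i], and every exponent is free of subtractions.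
    The inequality [q + 2i + 1 <= m] becomes [p + i < r]. *)
Section Recursion.
Variables (K : fieldType) (p i r : nat) (a b : K) (f : fps K).
Local Notation q := (p.+2 + i)%N.
Local Notation m := (r.+2 + i + i)%N.
Local Notation X := (@fps_Xn K).
Local Notation C := (@fps_const K).
Local Notation E := (1 - C a * X q - C b * X (p.+2 + m) * f).
Hypothesis gap : (p + i < r)%N.
Hypothesis fE : f * E = 1.

(** The complete quotients reached after whole periods. *)
Definition fps_remainder c : fps K := C c * X i + C b * X m * f.

Let binom_part c d : (q < d)%N ->
  (1 - C c * X q) 0%N = 1 /\ forall n, (d <= n)%N -> (1 - C c * X q) n = 0.
Proof.
move=> ltqd; split=> [|n ledn]; rewrite fps_coefD fps_coefN fps_coefCM /fps_Xn.
  by rewrite /= mulr0 subr0.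
by rewrite -fps_Xn0 /fps_Xn !gtn_eqF ?mulr0 ?subr0 //; lia.
Qed.

Let one_part d :
  (1 : fps K) 0%N = 1 /\ forall n, (d.+1 <= n)%N -> (1 : fps K) n = 0.
Proof. by split=> // n ltdn; rewrite -fps_Xn0 /fps_Xn gtn_eqF //; lia. Qed.

Let denomE : E = (1 - C a * X q) + X m.+2 * (C (- b) * (X p * f)).
Proof.
rewrite fps_constN; have -> : X (p.+2 + m) = X m.+2 * X p.
  by rewrite fps_XnD; congr X; lia.
ring.
Qed.

Let startE : (X m * f) * E = X m. Proof. by rewrite -mulrA fE mulr1. Qed.

Lemma hankel_start0 N : (0 < N <= m)%N -> hankel (X m * f) N = 0.
Proof.
have [|u0 _] := @binom_part a m.+2; first by lia.
by move=> hN; move: startE; rewrite denomE => /hankel_frac0; apply.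
Qed.

Lemma hankel_start N : hankel (X m * f) (m.+1 + N) =
  (-1) ^+ 'C(m.+1, 2) * b ^+ N * hankel (X p * f) N.
Proof.
have [|u0 u1] := @binom_part a m.+2; first by lia.
have:= startE; rewrite denomE => /hankel_frac -> //.
by rewrite hankelZ mulrA signrM2.
Qed.

(** The reductions of one period, for a fixed parameter [c] and
    [v = 1 / (E - c x^q)]. *)
Section Period.
Variables (c : K) (v : fps K).
Hypothesis vE : v * (E - C c * X q) = 1.

Let shiftedE : X p * v * (1 + X p.+2 * (C (- 1) * fps_remainder (a + c))) = X p.
Proof.
transitivity (X p * (v * (E - C c * X q))); last by rewrite vE mulr1.
rewrite -mulrA; congr (_ * (_ * _)).
rewrite /fps_remainder fps_constD fps_constN fps_const1 -!fps_XnD; ring.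
Qed.

Lemma hankel_shifted0 N : (0 < N <= p)%N -> hankel (X p * v) N = 0.
Proof. by move=> hN; apply: (hankel_frac0 shiftedE). Qed.

Lemma hankel_shifted N : hankel (X p * v) (p.+1 + N) =
  (-1) ^+ 'C(p.+1, 2) * hankel (fps_remainder (a + c)) N.
Proof.
rewrite (hankel_frac _ shiftedE) //; last by have [] := one_part p.+1.
by rewrite hankelZ mulrA signrM2 expr1n mulr1.
Qed.

Let crossE : X i * (1 - C c * X q * f) * (1 + X i.+2 * (C c * (X p * v))) = X i.
Proof.
have h := shift_inv (P := - (C c * X q)) fE vE.
transitivity (X i * ((1 + - (C c * X q) * f) * (1 - - (C c * X q) * v))).
  by rewrite (_ : X q = X i.+2 * X p); [ring | rewrite fps_XnD; congr X; lia].
by rewrite h mulr1.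
Qed.

Lemma hankel_cross0 N : (0 < N <= i)%N ->
  hankel (X i * (1 - C c * X q * f)) N = 0.
Proof. by move=> hN; apply: (hankel_frac0 crossE). Qed.

Lemma hankel_cross N : hankel (X i * (1 - C c * X q * f)) (i.+1 + N) =
  (-1) ^+ ('C(i.+1, 2) + N) * c ^+ N * hankel (X p * v) N.
Proof.
rewrite (hankel_frac _ crossE) //; last by have [] := one_part i.+1.
by rewrite hankelZ mulrA.
Qed.

(** The first two reductions of a period: [x^r w] is the second series of the
    expansion, with [w = 1 / (E + (b/c) x^(m-i))]. *)
Lemma hankel_remainder_nz : c != 0 -> exists w : fps K,
  [/\ forall N, (0 < N <= i)%N -> hankel (fps_remainder c) N = 0,
      forall N, hankel (fps_remainder c) (i.+1 + N) =
        (-1) ^+ 'C(i.+1, 2) * c ^+ i.+1 * b ^+ N * hankel (X r * w) N,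
      forall N, (0 < N <= r)%N -> hankel (X r * w) N = 0
    & forall N, hankel (X r * w) (r.+1 + N) =
        (-1) ^+ ('C(r.+1, 2) + N) * (b / c) ^+ N *
        hankel (X i * (1 - C c * X q * f)) N].
Proof.
move=> c0; have [k kE bE] : exists2 k, b / c = k & b = c * k.
  by exists (b / c); rewrite // mulrC divfK.
pose P := C k * X (r.+2 + i).
have [|w wE] := @fps_inv_ex _ (E + P).
  have [|u0 _] := @binom_part a m.+2; first by lia.
  rewrite denomE -addrA [_ + P]addrC addrA fps_coefD [in X in X + _]fps_coefD u0.
  by rewrite /P fps_coefCM !fps_coefXnM /= /fps_Xn /= mulr0 !addr0.
have remE : fps_remainder c = C c * (X i * (1 + P * f)).
  rewrite /fps_remainder /P [in LHS]bE -fps_constM.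
  by rewrite (_ : X m = X i * X (r.+2 + i)); [ring | rewrite fps_XnD; congr X; lia].
have remX : X i * (1 + P * f) * (1 + X i.+2 * (C (- k) * (X r * w))) = X i.
  transitivity (X i * ((1 + P * f) * (1 - P * w))); last first.
    by rewrite (shift_inv fE wE) mulr1.
  rewrite fps_constN /P.
  by rewrite (_ : X (r.+2 + i) = X i.+2 * X r); [ring | rewrite fps_XnD; congr X; lia].
have wX : X r * w * ((1 - C a * X q) +
    X r.+2 * (C k * (X i * (1 - C c * X q * f)))) = X r.
  transitivity (X r * (w * (E + P))); last by rewrite wE mulr1.
  rewrite -mulrA; congr (_ * (_ * _)).
  rewrite [in RHS]bE -(fps_constM c) /P.
  rewrite (_ : X (p.+2 + m) = X r.+2 * X i * X q).
    by rewrite -!fps_XnD; ring.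
  by rewrite !fps_XnD; congr X; lia.
exists w; split=> N; rewrite ?kE.
- by move=> hN; rewrite remE hankelZ (hankel_frac0 remX) ?mulr0.
- rewrite remE hankelZ (hankel_frac _ remX) //; last by have [] := one_part i.+1.
  rewrite hankelZ 2!mulrA -[X in X * _]mulrA signrM2 [in RHS]bE exprMn exprD.
  by ring.
- have [|u0 _] := @binom_part a m.+2; first by lia.
  by move=> hN; apply: (hankel_frac0 wX).
- have [|u0 u1] := @binom_part a r.+2; first by lia.
  by rewrite (hankel_frac _ wX) // hankelZ mulrA.
Qed.

(** For [c = 0] the remainder is a multiple of the initial series, so the period
    starts with a single reduction of size [m+1]. *)
Let remainder_c0 : c = 0 -> fps_remainder c = C b * (X m * f) /\ v = f.
Proof.
move=> c0; have C0 : C c = 0 by rewrite c0 fps_const0.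
split; first by rewrite /fps_remainder C0; ring.
transitivity (v * (f * E)); first by rewrite fE mulr1.
transitivity (f * (v * (E - C c * X q))); last by rewrite vE mulr1.
by rewrite C0; ring.
Qed.

Lemma hankel_remainder_left :
  hankel (fps_remainder c) i.+1 = (-1) ^+ 'C(i.+1, 2) * c ^+ i.+1.
Proof.
have [c0 | /hankel_remainder_nz [w [_ + _ _]]] := eqVneq c 0; last first.
  by move/(_ 0%N); rewrite addn0 !mulr1 {2}/hankel det_mx00 mulr1.
have [-> _] := remainder_c0 c0.
by rewrite hankelZ hankel_start0 ?c0 ?exprS ?mul0r ?mulr0 //; lia.
Qed.

Lemma hankel_remainder_right : hankel (fps_remainder c) (i.+1 + r.+1) =
  (-1) ^+ ('C(i.+1, 2) + 'C(r.+1, 2)) * b ^+ r.+1 * c ^+ i.+1.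
Proof.
have [c0 | /hankel_remainder_nz [w [_ -> _ /(_ 0%N)]]] := eqVneq c 0; last first.
  rewrite !addn0 mulr1 => ->; rewrite /hankel det_mx00 exprD; ring.
have [-> _] := remainder_c0 c0.
by rewrite hankelZ hankel_start0 ?c0 ?[0 ^+ _]exprS ?mul0r ?mulr0 //; lia.
Qed.

Lemma hankel_remainder0 N :
    (0 < N <= m)%N -> N <> i.+1 -> N <> (i.+1 + r.+1)%N ->
  hankel (fps_remainder c) N = 0.
Proof.
move=> hN Ni Nr; have [c0 | /hankel_remainder_nz [w [z1 e1 z2 e2]]] := eqVneq c 0.
  by have [-> _] := remainder_c0 c0; rewrite hankelZ hankel_start0 ?mulr0.
have [leNi|ltiN] := leqP N i; first by rewrite z1 //; lia.
rewrite -(subnKC ltiN) e1.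
have [leNr|ltrN] := leqP (N - i.+1) r; first by rewrite z2 ?mulr0 //; lia.
by rewrite -(subnKC ltrN) e2 hankel_cross0 ?mulr0 //; lia.
Qed.

(** For [c != 0] the powers of [c] cancel, which is why the result also covers
    [c = 0].  The signs of the two cases agree by [sign_bin2], as
    [m + 1 = (r + 1) + 2 (i + 1)]. *)
Lemma hankel_remainder_tail N : hankel (fps_remainder c) (m.+1 + N) =
  (-1) ^+ ('C(r.+1, 2) + i.+1) * b ^+ (N.*2 + m.+1) * hankel (X p * v) N.
Proof.
have [c0 | c0] := eqVneq c 0.
  have [-> ->] := remainder_c0 c0; rewrite hankelZ hankel_start.
  rewrite (_ : m.+1 = (r.+1 + i.+1.*2)%N); last by lia.
  by rewrite sign_bin2 -(addnn N) !(exprD b); ring.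
have [w [_ e1 _ e2]] := hankel_remainder_nz c0.
have -> : (m.+1 + N = i.+1 + (r.+1 + (i.+1 + N)))%N by lia.
rewrite e1 e2 hankel_cross.
have -> : (N.*2 + m.+1 = (r.+1 + (i.+1 + N)) + (i.+1 + N))%N by lia.
rewrite (exprD b (r.+1 + (i.+1 + N)) (i.+1 + N)).
have -> : (-1) ^+ ('C(r.+1, 2) + i.+1) = (-1) ^+ 'C(i.+1, 2) *
    (-1) ^+ ('C(r.+1, 2) + (i.+1 + N)) * (-1) ^+ ('C(i.+1, 2) + N) :> K.
  by rewrite -!exprD -signr_odd -[RHS]signr_odd; congr (_ ^+ nat_of_bool _); lia.
have -> : b ^+ (i.+1 + N) = (b / c) ^+ (i.+1 + N) * c ^+ i.+1 * c ^+ N.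
  by rewrite -mulrA -exprD -exprMn divfK.
ring.
Qed.

End Period.

Lemma shifted_inv_ex c : exists v, v * (E - C c * X q) = 1.
Proof.
apply: fps_inv_ex; have [|u0 _] := @binom_part a m.+2; first by lia.
rewrite denomE fps_coefD fps_coefN [in X in X + _]fps_coefD u0.
by rewrite fps_coefXnM /= fps_coefCM /fps_Xn /= mulr0 addr0 subr0.
Qed.

Lemma hankel_remainder_period c N : hankel (fps_remainder c) (m + p.+2 + N) =
  (-1) ^+ ('C(r.+1, 2) + i.+1 + 'C(p.+1, 2)) * b ^+ ((p.+1 + N).*2 + m.+1) *
  hankel (fps_remainder (a + c)) N.
Proof.
have [v vE] := shifted_inv_ex c.
have -> : (m + p.+2 + N = m.+1 + (p.+1 + N))%N by lia.
by rewrite (hankel_remainder_tail vE) (hankel_shifted vE) [in RHS]exprD; ring.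
Qed.

Lemma hankel_remainder_iter n c N :
  hankel (fps_remainder c) (n * (m + p.+2) + N) =
  (-1) ^+ (n * ('C(r.+1, 2) + i.+1 + 'C(p.+1, 2))) *
  b ^+ (n * (n * (m + p.+2) + p.+1 + N.*2)) *
  hankel (fps_remainder (n%:R * a + c)) N.
Proof.
set s := (_ + _ + 'C(p.+1, 2))%N.
elim: n c => [|n IHn] c; first by rewrite !mul0n !mul1r mul0r !add0r.
have -> : (n.+1 * (m + p.+2) + N = m + p.+2 + (n * (m + p.+2) + N))%N by lia.
rewrite hankel_remainder_period -/s IHn.
have -> : n%:R * a + (a + c) = n.+1%:R * a + c by rewrite -[n.+1%:R]natr1; ring.
have -> : (n.+1 * (n.+1 * (m + p.+2) + p.+1 + N.*2) =
    ((p.+1 + (n * (m + p.+2) + N)).*2 + m.+1) +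
    n * (n * (m + p.+2) + p.+1 + N.*2))%N by lia.
by rewrite (exprD b (_.*2 + m.+1)) (mulSn n s) (exprD _ s); ring.
Qed.

(** After one reduction the initial series stands at the last reduction of a period,
    with parameter [0]. *)
Let fE0 : f * (E - C 0 * X q) = 1.
Proof. by rewrite fps_const0 mul0r subr0. Qed.

(** Two reductions of sizes [m+1] and [l-1] lead from the initial series to the
    remainder of parameter [a]; the [n] periods that follow raise it to
    [(n+1) a]. *)
Lemma hankel_start_period n N :
  hankel (X m * f) (n.+1 * (m + p.+2) + N) =
  (-1) ^+ ('C(m.+1, 2) + 'C(p.+1, 2) + n * ('C(r.+1, 2) + i.+1 + 'C(p.+1, 2))) *
  b ^+ (n * n.+1 * (m + p.+2) + n.+1 * p.+1 + n.*2.+1 * N) *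
  hankel (fps_remainder (n.+1%:R * a)) N.
Proof.
have -> : (n.+1 * (m + p.+2) + N = m.+1 + (p.+1 + (n * (m + p.+2) + N)))%N by lia.
rewrite hankel_start (hankel_shifted fE0) addr0 hankel_remainder_iter.
have -> : n%:R * a + a = n.+1%:R * a by rewrite -[n.+1%:R]natr1; ring.
have -> : (n * n.+1 * (m + p.+2) + n.+1 * p.+1 + n.*2.+1 * N =
    (p.+1 + (n * (m + p.+2) + N)) + n * (n * (m + p.+2) + p.+1 + N.*2))%N by lia.
rewrite (exprD b (p.+1 + (_ + N))) (exprD _ (_ + 'C(p.+1, 2))).
by rewrite (exprD _ 'C(m.+1, 2)); ring.
Qed.

Lemma hankel_remainder_off c N : (0 < N < m + p.+2)%N ->
    N <> i.+1 -> N <> (i.+1 + r.+1)%N -> N <> m.+1 ->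
  hankel (fps_remainder c) N = 0.
Proof.
move=> hN Ni Nr Nm; have [v vE] := shifted_inv_ex c.
have [leNm|ltmN] := leqP N m; first by rewrite (hankel_remainder0 vE) //; lia.
rewrite -(subnKC ltmN) (hankel_remainder_tail vE) (hankel_shifted0 vE) ?mulr0 //.
by lia.
Qed.

Lemma hankel_start_off N : (0 < N < m + p.+2)%N -> N <> m.+1 ->
  hankel (X m * f) N = 0.
Proof.
move=> hN Nm; have [leNm|ltmN] := leqP N m; first by rewrite hankel_start0 //; lia.
by rewrite -(subnKC ltmN) hankel_start (hankel_shifted0 fE0) ?mulr0 //; lia.
Qed.

End Recursion.

(** * The Hankel determinants of the quadratic series *)

Theorem theorem22 (R : realType) (m l i q : nat) (a b : R[i]) (F : fps R[i])
    (hl : l = (q - i)%N) (hl2 : (2 <= l)%N) (hm : (q + 2 * i + 1 <= m)%N)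
    (hF : fps_is_quotient F (fps_Xn m)
            (fps_sub (fps_sub (fps_Xn 0) (fps_scale a (fps_Xn q)))
                     (fps_scale b (fps_mul (fps_Xn l) F)))) :
  hankel F (m + 1) = (-1) ^+ 'C(m + 1, 2) /\
  (forall n : nat,
    [/\ hankel F ((n + 1) * (m + l)) =
          (-1) ^ (n%:Z * ('C(m - 2 * i - 1, 2)%:Z + (i%:Z - 1))
                  + (n%:Z + 1) * 'C(l - 1, 2)%:Z + 'C(m + 1, 2)%:Z)
          * b ^ ((n%:Z + 1) ^+ 2 * (m%:Z + l%:Z) - (n%:Z + 1) * (m%:Z + 1)),
        hankel F ((n + 1) * (m + l) + i + 1) =
          (-1) ^ (n%:Z * ('C(m - 2 * i - 1, 2)%:Z + (i%:Z - 1))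
                  + (n%:Z + 1) * 'C(l - 1, 2)%:Z
                  + 'C(i + 1, 2)%:Z + 'C(m + 1, 2)%:Z)
          * b ^ ((n%:Z + 1) ^+ 2 * (m%:Z + l%:Z)
                 + n%:Z * (2 * i%:Z - m%:Z + 1) + i%:Z - m%:Z)
          * ((n%:R + 1) * a) ^+ (i + 1),
        hankel F ((n + 1) * (m + l) + m - i) =
          (-1) ^ ((n%:Z + 1) * ('C(m - 2 * i - 1, 2)%:Z + 'C(l - 1, 2)%:Z)
                  + n%:Z * (i%:Z - 1) + 'C(i + 1, 2)%:Z + 'C(m + 1, 2)%:Z)
          * b ^ ((n%:Z + 1) ^+ 2 * (l%:Z + m%:Z)
                 + n%:Z * (m%:Z - 2 * i%:Z - 1) + m%:Z - 3 * i%:Z - 2)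
          * ((n%:R + 1) * a) ^+ (i + 1)
      & hankel F ((n + 1) * (m + l) + m + 1) =
          (-1) ^ ((n%:Z + 1) * ('C(m - 2 * i - 1, 2)%:Z + 'C(l - 1, 2)%:Z
                                + i%:Z + 1)
                  + 'C(m + 1, 2)%:Z)
          * b ^ ((n%:Z + 1) ^+ 2 * (m%:Z + l%:Z) + (n%:Z + 1) * (m%:Z + 1))]) /\
  (forall N : nat, (0 < N)%N -> N <> (m + 1)%N ->
    (forall n : nat,
      [/\ N <> ((n + 1) * (m + l))%N,
          N <> ((n + 1) * (m + l) + i + 1)%N,
          N <> ((n + 1) * (m + l) + m - i)%N
        & N <> ((n + 1) * (m + l) + m + 1)%N]) ->
    hankel F N = 0).
Proof.
have [p lE] : exists p, l = p.+2 by exists (l - 2)%N; lia.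
have qE : q = (p.+2 + i)%N by lia.
have [r mE] : exists r, m = (r.+2 + i + i)%N by exists (m - i - i - 2)%N; lia.
have gap : (p + i < r)%N by lia.
move: hF => [_] /funext FD; clear hl hl2 hm; subst l q m.
set m := (r.+2 + i + i)%N in FD *.
pose D := 1 - fps_const a * fps_Xn (p.+2 + i) - fps_const b * (fps_Xn p.+2 * F).
have FD1 : F * D = fps_Xn m.
  rewrite -FD; congr (fps_mul F _); apply/funext => n.
  by rewrite /D !fps_coefD !fps_coefN !fps_coefCM.
have D0 : D 0%N = 1.
  rewrite /D !fps_coefD !fps_coefN !fps_coefCM fps_coefXnM /fps_Xn /=.
  by rewrite !mulr0 !subr0.
have [f Ff fD] := fps_factor FD1 D0.
have fE : f * (1 - fps_const a * fps_Xn (p.+2 + i) -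
    fps_const b * fps_Xn (p.+2 + m) * f) = 1.
  by rewrite -[RHS]fD /D Ff -(fps_XnD _ p.+2 m) !mulrA.
rewrite Ff; clear F FD FD1 D D0 Ff fD.
have natE n : (n + 1 = n.+1)%N by rewrite addn1.
have mE : (m - 2 * i - 1 = r.+1)%N by lia.
have hank0 (G : fps R[i]) : hankel G 0 = 1 by rewrite /hankel det_mx00.
split; [|split=> [n|N N0 Nm off]].
- rewrite addn1 -[X in hankel _ X]addn0 (hankel_start gap fE).
  by rewrite hank0 !mulr1.
- have [v vE] := shifted_inv_ex a b f gap (n.+1%:R * a).
  (* In the first three formulas the exponent [i - 1] stands where the expansion
     produces [i + 1], once per period. *)
  have sgn (z : int) (k : nat) : z = k%:Z - 2 * n%:Z ->
      (-1) ^ z = (-1) ^+ k :> R[i].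
    by move=> ->; apply: (@sign_exprz _ _ (- n%:Z)); rewrite mulrN.
  have pw (z : int) (k : nat) : z = k%:Z -> b ^ z = b ^+ k by move=> ->.
  rewrite mE subn1 /= !natE natr1.
  have := hankel_remainder_tail gap fE vE 0.
  have := hankel_remainder_right gap fE vE.
  have := hankel_remainder_left gap fE vE; have := hankel_start_period gap fE n.
  rewrite hank0 mulr1 -/m.
  move: 'C(m.+1, 2) 'C(p.+1, 2) 'C(r.+1, 2) 'C(i.+1, 2) => cm cp cr ci.
  move=> per left right tail; split.
  + rewrite -[X in hankel _ X]addn0 per hank0 mulr1 muln0 addn0; congr (_ * _).
      by apply/esym/sgn; lia.
    by apply/esym/pw; lia.
  + rewrite -addnS per left !mulrA; congr (_ * _).
    rewrite mulrAC -exprD; congr (_ * _).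
      by apply/esym/sgn; lia.
    by apply/esym/pw; lia.
  + have -> : (n.+1 * (m + p.+2) + m - i = n.+1 * (m + p.+2) + (i.+1 + r.+1))%N.
      by lia.
    rewrite per right mulrA mulrACA -!exprD; congr (_ * _ * _).
      by apply/esym/sgn; lia.
    by apply/esym/pw; lia.
  + rewrite -addnS -[m.+1]addn0 per tail mulrACA -!exprD; congr (_ * _).
      by apply/esym/(@sign_exprz _ _ 0); lia.
    by apply/esym/pw; lia.
- have [ltN|leN] := ltnP N (m + p.+2).
    by apply: (hankel_start_off gap fE) => //; lia.
  (* [N] lies at offset [s] in period [k]. *)
  have := divn_eq N (m + p.+2); have := ltn_pmod N (isT : 0 < m + p.+2)%N.
  have : (0 < N %/ (m + p.+2))%N by rewrite divn_gt0.
  move: (N %/ _)%N (N %% _)%N => [//|k] s _ lts NE.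
  have [] := off k; rewrite natE => o1 o2 o3 o4.
  rewrite NE (hankel_start_period gap fE).
  have -> : hankel (fps_remainder i r b f (k.+1%:R * a)) s = 0; last exact: mulr0.
  by apply: (hankel_remainder_off gap fE); lia.
Qed.
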